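(* Let $H$ be a weakly nilpotent hypergroup, and let $T$ be a closed subset of $H$. Then $H//T$ is a weakly nilpotent hypergroup.
   Context: A hypergroup is a set $H$ with a hypermultiplication, i.e. a map $H\times H\to \mathcal P(H)$, $(p,q)\mapsto pq$ (the power set of $H$), where for subsets $P,Q\subseteq H$ one puts $PQ:=\bigcup_{p\in P,q\in Q}pq$, and $pQ:=\{p\}Q$, $Qp:=Q\{p\}$, such that: (i) $p(qr)=(pq)r$ for all $p,q,r\in H$; (ii) there is an element $1\in H$ with $s1=\{s\}$ for all $s\in H$; (iii) for each $s\in H$ there is an element $s^*\in H$ such that for all $p,q,r\in H$ with $r\in pq$ one has $q\in p^*r$ and $p\in rq^*$. A singleton $\{s\}$ is sometimes written $s$. For $S\subseteq H$, $S^*:=\{s^*: s\in S\}$. A nonempty subset $F\subseteq H$ is closed if $F^*F\subseteq F$; a closed subset is itself a hypergroup under the restricted hypermultiplication. A closed subset $F$ of $H$ is normal in $H$ if $Fh\subseteq hF$ for all $h\in H$. Quotient: for a closed subset $F$ of $H$ and $h\in H$ put $h^F:=FhF$, and for $F\subseteq S\subseteq H$ put $S//F:=\{h^F: h\in S\}$. With $a^F\cdot b^F:=\{x^F: x\in aFb\}$ the set $H//F$ is a hypergroup, with identity $1^F=F$ and $(h^F)^*=(h^* )^F$. Centre: $Z(H):=\{h\in H: hx=xh \text{ for all } x\in H,\ h^*h=\{1\}\}$. Upper center series: $Z_0(H)=\{1\}$, and for $i\ge1$, $Z_i(H)$ is determined by $Z_i(H)//Z_{i-1}(H)=Z(H//Z_{i-1}(H))$,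 i.e. $Z_i(H)=\{h\in H: h^{Z_{i-1}(H)}\in Z(H//Z_{i-1}(H))\}$; each $Z_i(H)$ is a normal closed subset of $H$. A hypergroup $H$ is weakly nilpotent if $Z_n(H)=H$ for some non-negative integer $n$. *)

(* Defs.v *)
From HB Require Import structures.
From mathcomp Require Import all_boot.
From mathcomp Require Import boolp classical_sets.

Set Implicit Arguments.
Unset Strict Implicit.
Unset Printing Implicit Defensive.

Local Open Scope classical_set_scope.

Definition set_hmul (T : Type) (mul : T -> T -> set T) (P Q : set T) : set T :=
  \bigcup_(p in P) \bigcup_(q in Q) mul p q.

(* The identity and the map s |-> s^* are uniquely determined by the axioms,
   so carrying them as data adds nothing to their mere existence. *)
HB.mixin Record isHypergroup (H : Type) := {
  hmul : H -> H -> set H;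
  hone : H;
  hstar : H -> H;
  hmulA : forall p q r : H,
    set_hmul hmul [set p] (hmul q r) = set_hmul hmul (hmul p q) [set r];
  hmulx1 : forall s : H, hmul s hone = [set s];
  hmul_star : forall p q r : H,
    hmul p q r -> hmul (hstar p) r q /\ hmul r (hstar q) p
}.

#[short(type="hypergroupType")]
HB.structure Definition Hypergroup := {H of isHypergroup H}.

Arguments hone {s}.

Declare Scope hypergroup_scope.
Notation "P ** Q" := (set_hmul hmul P Q)
  (at level 40, left associativity) : hypergroup_scope.
Local Open Scope hypergroup_scope.

Definition hclosed (H : hypergroupType) (F : set H) : Prop :=
  F !=set0 /\ (@hstar H @` F) ** F `<=` F.

Record closedSubset (H : hypergroupType) := ClosedSubset {
  cset :> set H;
  csetP : hclosed cset
}.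

Section HypergroupTheory.
Variable H : hypergroupType.
Implicit Types (p q r s x y : H) (P Q R : set H) (F : closedSubset H).

Lemma set_hmulP P Q x :
  (P ** Q) x <-> exists p q, [/\ P p, Q q & hmul p q x].
Proof.
split; first by case=> p Pp [q Qq h]; exists p, q.
by case=> p [q [Pp Qq h]]; exists p => //; exists q.
Qed.

Lemma set_hmul11 p q : [set p] ** [set q] = hmul p q.
Proof. by rewrite /set_hmul !bigcup_set1. Qed.

Lemma set_hmulA P Q R : P ** (Q ** R) = P ** Q ** R.
Proof.
apply/seteqP; split=> x /set_hmulP.
- case=> p [u [Pp /set_hmulP[q [r [Qq Rr qru]]] pux]].
  have : ([set p] ** hmul q r) x by apply/set_hmulP; exists p, u.
  rewrite hmulA => /set_hmulP[v [r' [pqv -> vrx]]].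
  by apply/set_hmulP; exists v, r; split=> //; apply/set_hmulP; exists p, q.
- case=> u [r [/set_hmulP[p [q [Pp Qq pqu]]] Rr urx]].
  have : (hmul p q ** [set r]) x by apply/set_hmulP; exists u, r.
  rewrite -hmulA => /set_hmulP[p' [v [-> qrv pvx]]].
  by apply/set_hmulP; exists p, v; split=> //; apply/set_hmulP; exists q, r.
Qed.

Lemma set_hmulS P P' Q Q' : P `<=` P' -> Q `<=` Q' -> P ** Q `<=` P' ** Q'.
Proof.
move=> sP sQ x /set_hmulP[p [q [Pp Qq h]]].
by apply/set_hmulP; exists p, q; split; [exact: sP|exact: sQ|].
Qed.

Lemma hmul_starl p q r : hmul p q r -> hmul (hstar p) r q.
Proof. by case/hmul_star. Qed.

Lemma hmul_starr p q r : hmul p q r -> hmul r (hstar q) p.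
Proof. by case/hmul_star. Qed.

Lemma hmulx1P s : hmul s hone s.
Proof. by rewrite hmulx1. Qed.

Lemma hmulVx s : hmul (hstar s) s hone.
Proof. exact: hmul_starl (hmulx1P s). Qed.

Lemma hstarK s : hstar (hstar s) = s.
Proof. by have := hmul_starl (hmulVx s); rewrite hmulx1 => <-. Qed.

Lemma hmulxV s : hmul s (hstar s) hone.
Proof. by rewrite -{1}[s]hstarK; exact: hmulVx. Qed.

Lemma hmul1x s : hmul hone s = [set s].
Proof.
apply/seteqP; split=> x /=; last first.
  by move=> ->; have := hmul_starr (hmulxV s); rewrite hstarK.
move=> /hmul_starr /hmul_starl; rewrite hmulx1 => h.
by rewrite -[x]hstarK -h hstarK.
Qed.

Lemma hstar1 : hstar (@hone H) = hone.
Proof. by have := hmulVx (@hone H); rewrite hmulx1 => <-. Qed.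

Lemma hstarM p q r : hmul p q r -> hmul (hstar q) (hstar p) (hstar r).
Proof. by move=> /hmul_starl /hmul_starr /hmul_starl. Qed.

Lemma hclosed1 : hclosed [set @hone H].
Proof.
split; first by exists hone.
move=> x /set_hmulP[_ [_ [[_ -> <-] ->]]].
by rewrite hstar1 hmulx1.
Qed.

Lemma cset1 F : cset F hone.
Proof.
have [[f Ff] sF] := csetP F.
apply: sF; apply/set_hmulP; exists (hstar f), f; split=> //.
exact: hmulVx.
Qed.

Lemma csetV F x : cset F x -> cset F (hstar x).
Proof.
move=> Fx; have [_ sF] := csetP F; apply: sF; apply/set_hmulP.
by exists (hstar x), hone; split; [exists x|exact: cset1|exact: hmulx1P].
Qed.

Lemma csetM F : F ** F = F.
Proof.
apply/seteqP; split=> x.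
  move=> /set_hmulP[f [g [Ff Fg fgx]]].
  have [_ sF] := csetP F; apply: sF; apply/set_hmulP; exists f, g; split=> //.
  by exists (hstar f); [exact: csetV|exact: hstarK].
move=> Fx; apply/set_hmulP; exists x, hone.
by split=> //; [exact: cset1|exact: hmulx1P].
Qed.

Definition dcoset F (h : H) : set H := F ** [set h] ** F.

Lemma dcosetP F h x :
  dcoset F h x <-> exists f u g, [/\ cset F f, cset F g, hmul f h u & hmul u g x].
Proof.
split.
  case/set_hmulP=> u [g [/set_hmulP[f [_ [Ff -> fhu]]] Fg ugx]].
  by exists f, u, g.
case=> f [u [g [Ff Fg fhu ugx]]]; apply/set_hmulP; exists u, g; split=> //.
by apply/set_hmulP; exists f, h.
Qed.

Lemma dcoset_id F h : dcoset F h h.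
Proof.
apply/dcosetP; exists hone, h, hone; rewrite hmul1x.
by split=> //; [exact: cset1..|exact: hmulx1P].
Qed.

Lemma dcoset_star F h x : dcoset F h x -> dcoset F (hstar h) (hstar x).
Proof.
case/dcosetP=> f [u [g [Ff Fg fhu ugx]]].
suff : (F ** ([set hstar h] ** F)) (hstar x) by rewrite set_hmulA.
apply/set_hmulP; exists (hstar g), (hstar u); split.
- exact: csetV.
- apply/set_hmulP; exists (hstar h), (hstar f).
  by split=> //; [exact: csetV|exact: hstarM].
- exact: hstarM.
Qed.

Lemma dcosetMl F h : F ** dcoset F h = dcoset F h.
Proof. by rewrite /dcoset !set_hmulA csetM. Qed.

Lemma dcosetMr F h : dcoset F h ** F = dcoset F h.
Proof. by rewrite /dcoset -!set_hmulA csetM. Qed.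

Lemma dcoset_sub F x y : dcoset F x y -> dcoset F y `<=` dcoset F x.
Proof.
move=> xy; rewrite -[X in _ `<=` X]dcosetMr -[X in _ `<=` X ** _]dcosetMl.
apply: set_hmulS => //; apply: set_hmulS => // _ -> //.
Qed.

Lemma dcoset_sym F x y : dcoset F x y -> dcoset F y x.
Proof.
case/dcosetP=> f [u [g [Ff Fg fxu ugy]]].
suff : (F ** ([set y] ** F)) x by rewrite set_hmulA.
apply/set_hmulP; exists (hstar f), u; split.
- exact: csetV.
- apply/set_hmulP; exists y, (hstar g).
  by split=> //; [exact: csetV|exact: hmul_starr].
- exact: hmul_starl.
Qed.

Lemma dcoset_eq F x y : dcoset F x y -> dcoset F y = dcoset F x.
Proof. by move=> xy; apply/seteqP; split; apply: dcoset_sub => //; exact: dcoset_sym. Qed.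

(* The set H//F, as the type of all double cosets FhF. *)
Definition quotient F : Type := {A : set H | exists h, A = dcoset F h}.

Definition quot F (h : H) : quotient F :=
  exist _ (dcoset F h) (ex_intro _ h erefl).

Definition quotient_mul F (A B : quotient F) : set (quotient F) :=
  [set X | exists a b,
    [/\ A = quot F a, B = quot F b
      & (quot F @` ([set a] ** F ** [set b])) X]].

Lemma quotient_inj F (A B : quotient F) : sval A = sval B -> A = B.
Proof. by case: A B => [A hA] [B hB] /= AB; subst B; congr exist. Qed.

Lemma quot_eqP F x y : quot F x = quot F y <-> dcoset F x y.
Proof.
split; last by move=> /dcoset_eq e; apply: quotient_inj.
by move=> /(congr1 sval) /= ->; exact: dcoset_id.
Qed.

Lemma quot_surj F (A : quotient F) : exists h, A = quot F h.
Proof. by case: (svalP A) => h e; exists h; apply: quotient_inj. Qed.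

Lemma quotient_mul_mem F (a b x : H) :
  (quot F @` ([set a] ** F ** [set b])) (quot F x) <->
  (dcoset F a ** dcoset F b) x.
Proof.
have -> : dcoset F a ** dcoset F b = F ** ([set a] ** F ** [set b]) ** F.
  by rewrite /dcoset !set_hmulA -[F ** [set a] ** F ** F]set_hmulA csetM.
split.
  case=> y aby /quot_eqP yx.
  move: yx; apply: set_hmulS => //; apply: set_hmulS => //.
  by move=> _ ->.
case/set_hmulP=> u [g [/set_hmulP[f [y [Ff aby fyu]]] Fg ugx]].
by exists y => //; apply/quot_eqP/dcosetP; exists f, u, g.
Qed.

Lemma quotient_mulP F (A B : quotient F) x :
  quotient_mul A B (quot F x) <-> (sval A ** sval B) x.
Proof.
split.
  by case=> a [b [-> -> /quotient_mul_mem]].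
have [[a ->] [b ->]] := (quot_surj A, quot_surj B).
by move=> /quotient_mul_mem h; exists a, b.
Qed.

(* The product does not depend on the chosen representatives. *)
Lemma quotient_mulE F (a b : H) :
  quotient_mul (quot F a) (quot F b) = quot F @` ([set a] ** F ** [set b]).
Proof.
apply/seteqP; split=> X; have [x ->] := quot_surj X.
  by move=> /quotient_mulP /quotient_mul_mem.
by move=> h; exists a, b.
Qed.

Lemma quotient_star_subproof F (A : quotient F) :
  exists h, @hstar H @` sval A = dcoset F h.
Proof.
have [a ->] := quot_surj A; exists (hstar a).
apply/seteqP; split=> x /=; first by case=> y /dcoset_star + <-.
move=> /dcoset_star; rewrite hstarK => h.
by exists (hstar x) => //; rewrite hstarK.
Qed.

Definition quotient_star F (A : quotient F) : quotient F :=
  exist _ (@hstar H @` sval A) (quotient_star_subproof A).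

Lemma quotient_starE F (h : H) :
  quotient_star (quot F h) = quot F (hstar h).
Proof.
apply: quotient_inj; case: (quotient_star_subproof (quot F h)) => a /= e.
rewrite e; apply/esym/dcoset_eq; rewrite -e.
by exists h => //; exact: dcoset_id.
Qed.

Definition quotient_one F : quotient F := quot F hone.

Lemma dcoset1 F : dcoset F hone = F.
Proof.
apply/seteqP; split=> x.
  move=> h; suff : (F ** F ** F) x by rewrite !csetM.
  move: h; apply: set_hmulS => //; apply: set_hmulS => //.
  by move=> _ ->; exact: cset1.
move=> Fx; apply/dcosetP; exists x, x, hone.
by split=> //; [exact: cset1|exact: hmulx1P..].
Qed.

Lemma sval_quotientMl F (A : quotient F) : F ** sval A = sval A.
Proof. by have [a ->] := quot_surj A; exact: dcosetMl. Qed.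

Lemma sval_quotientMr F (A : quotient F) : sval A ** F = sval A.
Proof. by have [a ->] := quot_surj A; exact: dcosetMr. Qed.

Lemma quotient_mulA F (A B C : quotient F) :
  set_hmul (@quotient_mul F) [set A] (quotient_mul B C) =
  set_hmul (@quotient_mul F) (quotient_mul A B) [set C].
Proof.
apply/seteqP; split=> X; have [x ->] := quot_surj X.
- case=> _ -> [Y]; have [y ->] := quot_surj Y => /quotient_mulP BCy.
  move=> /quotient_mulP /= h.
  have : (sval A ** (F ** (sval B ** sval C) ** F)) x.
    by move: h; apply: set_hmulS => //; do 2!apply: set_hmulS => //; move=> _ ->.
  rewrite -[F ** _ ** F]set_hmulA -[sval B ** _ ** _]set_hmulA.
  rewrite sval_quotientMr !set_hmulA sval_quotientMr.
  move=> /set_hmulP[u [c [ABu Cc ucx]]].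
  exists (quot F u); first exact/quotient_mulP.
  exists C => //; apply/quotient_mulP/set_hmulP; exists u, c; split=> //.
  exact: dcoset_id.
- case=> Y; have [y ->] := quot_surj Y => /quotient_mulP ABy [_ ->].
  move=> /quotient_mulP /= h.
  have : (F ** (sval A ** sval B) ** F ** sval C) x.
    by move: h; apply: set_hmulS => //; do 2!apply: set_hmulS => //; move=> _ ->.
  rewrite -set_hmulA sval_quotientMl set_hmulA sval_quotientMl -set_hmulA.
  move=> /set_hmulP[a [u [Aa BCu aux]]].
  exists A => //; exists (quot F u); first exact/quotient_mulP.
  apply/quotient_mulP/set_hmulP; exists a, u; split=> //.
  exact: dcoset_id.
Qed.

Lemma quotient_mulx1 F (A : quotient F) :
  quotient_mul A (quotient_one F) = [set A].
Proof.
have [a ->] := quot_surj A.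
apply/seteqP; split=> X; have [x ->] := quot_surj X.
  move=> /quotient_mulP /=; rewrite dcoset1 dcosetMr => ax.
  by apply/esym/quot_eqP.
move=> /= /esym/quot_eqP ax; apply/quotient_mulP => /=.
by rewrite dcoset1 dcosetMr.
Qed.

Lemma quotient_mul_star F (A B C : quotient F) : quotient_mul A B C ->
  quotient_mul (quotient_star A) C B /\ quotient_mul C (quotient_star B) A.
Proof.
have [c ->] := quot_surj C.
move=> /quotient_mulP /set_hmulP[a [b [Aa Bb abc]]].
have mem (D : quotient F) d : sval D d -> D = quot F d.
  have [d' ->] := quot_surj D; exact: (quot_eqP _ _ _).2.
rewrite [A](mem A a)// [B](mem B b)// !quotient_starE.
split; apply/quotient_mulP/set_hmulP.
- exists (hstar a), c; split; [exact: dcoset_id..|exact: hmul_starl].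
- exists c, (hstar b); split; [exact: dcoset_id..|exact: hmul_starr].
Qed.

HB.instance Definition _ F := isHypergroup.Build (quotient F)
  (@quotient_mulA F) (@quotient_mulx1 F) (@quotient_mul_star F).

Definition hcenter : set H :=
  [set h | (forall x, hmul h x = hmul x h) /\ hmul (hstar h) h = [set hone]].

Lemma hcenter_closed : hclosed hcenter.
Proof.
split.
  exists hone; split=> [x|]; first by rewrite hmul1x hmulx1.
  by rewrite hstar1 hmulx1.
move=> x /set_hmulP[_ [b [[a [aC aV] <-] [bC bV] abx]]].
have aV' : hmul a (hstar a) = [set hone] by rewrite aC.
have one_l P : [set hone] ** P = P.
  apply/seteqP; split=> y; first by case=> _ -> [p Pp]; rewrite hmul1x => ->.
  by move=> Py; exists hone => //; exists y => //; rewrite hmul1x.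
have one_r P : P ** [set hone] = P.
  apply/seteqP; split=> y; first by case=> p Pp [_ ->]; rewrite hmulx1 => ->.
  by move=> Py; exists y => //; exists hone => //; rewrite hmulx1.
have aVC y : [set hstar a] ** [set y] = [set y] ** [set hstar a].
  rewrite -[LHS]one_r -aV' -(set_hmul11 a) -set_hmulA (set_hmulA [set y]).
  by rewrite set_hmul11 -aC -set_hmul11 !set_hmulA set_hmul11 aV one_l.
have abE : hmul (hstar a) b = [set x].
  apply/seteqP; split=> [y aby|_ -> //].
  have := hmul_starl abx; rewrite hstarK => axb.
  suff : ([set hstar a] ** ([set a] ** [set x])) y.
    by rewrite set_hmulA set_hmul11 aV one_l.
  by exists (hstar a) => //; exists b => //; rewrite set_hmul11.
have xE : [set x] = [set hstar a] ** [set b] by rewrite set_hmul11.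
split=> [y|].
  rewrite -!set_hmul11 xE -set_hmulA (set_hmul11 b) bC -set_hmul11 !set_hmulA.
  by rewrite aVC.
apply/seteqP; split=> y; last by move=> ->; exact: hmulVx.
rewrite -set_hmul11 xE.
have -> : [set hstar x] = [set hstar b] ** [set a].
  rewrite set_hmul11; apply/seteqP; split=> [_ ->|z].
    by have := hstarM abx; rewrite hstarK.
  by move=> /hstarM; rewrite hstarK abE => /(congr1 (@hstar H)); rewrite hstarK.
rewrite -set_hmulA (set_hmulA [set a]) (set_hmul11 a) aV' one_l.
by rewrite set_hmul11 bV.
Qed.

End HypergroupTheory.

Arguments hcenter : clear implicits.

Lemma quot_preimage_closed (H : hypergroupType) (F : closedSubset H)
    (C : set (quotient F)) :
  hclosed C -> hclosed [set h | C (quot F h)].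
Proof.
move=> [[X CX] sC]; split.
  by have [h e] := quot_surj X; exists h; rewrite /= -e.
move=> x /set_hmulP[_ [b [[a Ca <-] Cb abx]]]; apply: sC.
apply/set_hmulP; exists (hstar (quot F a)), (quot F b); split=> //.
have -> : hstar (quot F a) = quot F (hstar a) by exact: quotient_starE.
apply/quotient_mulP/set_hmulP; exists (hstar a), b.
by split=> //; exact: dcoset_id.
Qed.

Fixpoint upper_center (H : hypergroupType) (i : nat) : closedSubset H :=
  if i is j.+1 then
    @ClosedSubset H
      [set h | hcenter (quotient (upper_center H j)) (quot (upper_center H j) h)]
      (quot_preimage_closed (@hcenter_closed (quotient (upper_center H j))))
  else ClosedSubset (@hclosed1 H).

Definition weakly_nilpotent (H : hypergroupType) : Prop :=
  exists n, upper_center H n = setT :> set H.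

(* Main.v *)
Require Import Defs.
From mathcomp Require Import all_boot.
From mathcomp Require Import boolp classical_sets.

(** Write Z_i for the terms of the upper center series of H and W_i for those of
    H//T.  The theorem follows from the claim that h^T lies in W_i whenever h
    lies in Z_i: if Z_n is all of H, then W_n is all of H//T.

    The claim is proved by induction on i.  Let V be the set of all h with h^T
    in W_i.  It is a closed subset of H, and it contains Z_i by induction, so
    two facts suffice.

    - Centrality passes to coarser quotients ([hcenter_quot_sub]): if Z and V
      are closed, Z is contained in V and h^Z is central in H//Z, then h^V is
      central in H//V.  The point is that such an h commutes with V as a set:
      Z h* Z h Z = Z makes h normalize Z, so that h^Z = hZ = Zh, and h^Z commutes
      with every set that, like V, is a union of double cosets of Z.

    - Centrality passes from H//V to (H//T)//W_i ([hcenter_quot_quot]), which is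
      the part needed here of the isomorphism between these two hypergroups.
      Taking preimages under h |-> h^T preserves complex products, and the
      preimage of the double coset of h^T modulo W_i is V h V. *)

Set Implicit Arguments.
Unset Strict Implicit.
Unset Printing Implicit Defensive.

Local Open Scope classical_set_scope.
Local Open Scope hypergroup_scope.

Section CentralDoubleCosets.
Variable H : hypergroupType.
Implicit Types (h x : H) (P : set H) (F Z V : closedSubset H).

Lemma set_hmul1s P : [set hone] ** P = P.
Proof.
apply/seteqP; split=> y.
  by case/set_hmulP=> _ [p [-> Pp]]; rewrite hmul1x => ->.
by move=> Py; apply/set_hmulP; exists hone, y; rewrite hmul1x.
Qed.

Lemma set_hmuls1 P : P ** [set hone] = P.
Proof.
apply/seteqP; split=> y.
  by case/set_hmulP=> p [_ [Pp ->]]; rewrite hmulx1 => ->.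
by move=> Py; apply/set_hmulP; exists y, hone; rewrite hmulx1.
Qed.

Lemma cset_mulSl Z V : Z `<=` V -> Z ** V = V.
Proof.
move=> ZV; apply/seteqP; split; first by rewrite -[X in _ `<=` X]csetM; apply: set_hmulS.
by rewrite -[X in X `<=` _]set_hmul1s; apply: set_hmulS => // _ ->; exact: cset1.
Qed.

Lemma cset_mulSr Z V : Z `<=` V -> V ** Z = V.
Proof.
move=> ZV; apply/seteqP; split; first by rewrite -[X in _ `<=` X]csetM; apply: set_hmulS.
by rewrite -[X in X `<=` _]set_hmuls1; apply: set_hmulS => // _ ->; exact: cset1.
Qed.

(** Insert [h h*], which contains the identity, on the left of [P]. *)
Lemma set_hmulVK h P : P `<=` [set h] ** ([set hstar h] ** P).
Proof.
rewrite set_hmulA set_hmul11 -[X in X `<=` _]set_hmul1s.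
by apply: set_hmulS => // _ ->; exact: hmulxV.
Qed.

Lemma set_hmulKV h P : P `<=` P ** [set hstar h] ** [set h].
Proof.
rewrite -set_hmulA set_hmul11 -[X in X `<=` _]set_hmuls1.
by apply: set_hmulS => // _ ->; exact: hmulVx.
Qed.

(** Centrality in the quotient, read off on double cosets in the hypergroup.
    The condition [h* F h `<=` F] is equivalent to [F h* F h F = F], because the
    left-hand side of the latter always contains [F]. *)
Lemma hcenter_quotP F h :
  hcenter (quotient F) (quot F h) <->
  (forall x, dcoset F h ** dcoset F x = dcoset F x ** dcoset F h) /\
  [set hstar h] ** F ** [set h] `<=` F.
Proof.
split=> [[hC hV]|[hC hV]]; split.
- move=> x; have E : quotient_mul (quot F h) (quot F x) =
    quotient_mul (quot F x) (quot F h) := hC _.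
  apply/seteqP; split=> y.
    move=> /(quotient_mulP (quot F h) (quot F x)); rewrite E.
    by move=> /quotient_mulP.
  move=> /(quotient_mulP (quot F x) (quot F h)); rewrite -E.
  by move=> /quotient_mulP.
- move=> y hy.
  have : hmul (hstar (quot F h)) (quot F h) (quot F y).
    suff : quotient_mul (quotient_star (quot F h)) (quot F h) (quot F y) by [].
    by rewrite quotient_starE quotient_mulE; exists y.
  by rewrite hV => /= /esym /quot_eqP; rewrite dcoset1.
- move=> X; have [x ->] := quot_surj X.
  apply/seteqP; split=> Y; have [y ->] := quot_surj Y => /quotient_mulP e;
    apply/quotient_mulP; move: e => /=.
    by rewrite hC.
  by rewrite hC.
- apply/seteqP; split=> Y; last by move=> ->; exact: hmulVx.
  have [y ->] := quot_surj Y => e.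
  have : quotient_mul (quotient_star (quot F h)) (quot F h) (quot F y) by [].
  rewrite quotient_starE quotient_mulE => -[x hx /esym/quot_eqP xy].
  apply/esym/quot_eqP; rewrite dcoset1.
  have /dcoset_eq Ex : dcoset F hone x by rewrite dcoset1; exact: hV.
  by move/dcoset_sym: xy; rewrite Ex dcoset1.
Qed.

(** A set stable under [F] on both sides is a union of double cosets of [F]. *)
Lemma dcoset_comm_stable F h P :
  (forall x, dcoset F h ** dcoset F x = dcoset F x ** dcoset F h) ->
  F ** P = P -> P ** F = P -> dcoset F h ** P = P ** dcoset F h.
Proof.
move=> hC FP PF.
have xP x : P x -> dcoset F x `<=` P.
  move=> Px; rewrite -PF -[X in X ** _]FP.
  by apply: set_hmulS => //; apply: set_hmulS => // _ ->.
apply/seteqP; split=> y /set_hmulP[a [b [Pa Pb aby]]].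
  have : (dcoset F h ** dcoset F b) y.
    by apply/set_hmulP; exists a, b; split=> //; exact: dcoset_id.
  by rewrite hC; apply: set_hmulS => //; exact: xP.
have : (dcoset F a ** dcoset F h) y.
  by apply/set_hmulP; exists a, b; split=> //; exact: dcoset_id.
by rewrite -hC; apply: set_hmulS => //; exact: xP.
Qed.

(** The inclusion [h* F h `<=` F] gives [F h `<=` h F].  The reverse inclusion
    comes from the same fact for [h*], which is again central modulo [F]. *)
Lemma hcenter_quot_normal F h :
  hcenter (quotient F) (quot F h) -> F ** [set h] = [set h] ** F.
Proof.
move=> hZ.
have [hC hV] := (hcenter_quotP _ _).1 hZ.
have hV' : [set h] ** F ** [set hstar h] `<=` F.
  have : hcenter (quotient F) (quot F (hstar h)).
    rewrite -quotient_starE.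
    exact: (@csetV _ (ClosedSubset (@hcenter_closed (quotient F)))).
  by case/hcenter_quotP => _; rewrite hstarK.
apply/seteqP; split.
  apply: (subset_trans (@set_hmulVK h _)).
  by rewrite [_ ** (F ** _)]set_hmulA; apply: set_hmulS.
apply: (subset_trans (@set_hmulKV h _)).
by apply: set_hmulS.
Qed.

(** Centrality in [H//Z] yields [V h = h V], since [h^Z = h Z = Z h] commutes with
    [V].  So the [V] in the middle of [V h V x V], [V x V h V] and [h* V h] can be
    moved away, after which the relations modulo [Z] apply. *)
Lemma hcenter_quot_sub Z V h : Z `<=` V ->
  hcenter (quotient Z) (quot Z h) -> hcenter (quotient V) (quot V h).
Proof.
move=> ZV hZ; have nZ := hcenter_quot_normal hZ.
have [hC hV] := (hcenter_quotP _ _).1 hZ.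
have [ZVl ZVr] := (cset_mulSl ZV, cset_mulSr ZV).
have dZ : dcoset Z h = [set h] ** Z by rewrite /dcoset nZ -set_hmulA csetM.
have nV : V ** [set h] = [set h] ** V.
  have := dcoset_comm_stable hC ZVl ZVr.
  by rewrite {1}dZ -set_hmulA ZVl dZ -nZ set_hmulA ZVr.
apply/hcenter_quotP; split=> [x|].
  have dV : dcoset V h = [set h] ** V by rewrite /dcoset nV -set_hmulA csetM.
  have xZl : Z ** dcoset V x = dcoset V x by rewrite /dcoset !set_hmulA ZVl.
  have xZr : dcoset V x ** Z = dcoset V x by rewrite /dcoset -!set_hmulA ZVr.
  have := dcoset_comm_stable hC xZl xZr.
  rewrite {1}dZ -set_hmulA xZl dZ -nZ set_hmulA xZr => hx.
  by rewrite {1}dV [dcoset V h]dV -[in RHS]nV -set_hmulA dcosetMl set_hmulA dcosetMr.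
rewrite -set_hmulA nV set_hmulA -[X in _ `<=` X]csetM; apply: set_hmulS => //.
apply: subset_trans ZV; apply: subset_trans hV.
rewrite -[X in X ** [set h]]set_hmuls1.
by apply: set_hmulS => //; apply: set_hmulS => // _ ->; exact: cset1.
Qed.

End CentralDoubleCosets.

Section QuotientOfQuotient.
Variables (H : hypergroupType) (T : closedSubset H).
Implicit Types (A B : set (quotient T)) (W : closedSubset (quotient T)).

Lemma quot_preimageM A B :
  quot T @^-1` (A ** B) = (quot T @^-1` A) ** (quot T @^-1` B).
Proof.
apply/seteqP; split=> x.
  case/set_hmulP=> X [Y [AX BY /quotient_mulP]].
  have [[a eX] [b eY]] := (quot_surj X, quot_surj Y); subst X Y.
  case/set_hmulP=> u [v [/quot_eqP au /quot_eqP bv uvx]].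
  by apply/set_hmulP; exists u, v; rewrite /preimage /= -au -bv.
case/set_hmulP=> a [b [Aa Bb abx]].
apply/set_hmulP; exists (quot T a), (quot T b); split=> //.
apply/quotient_mulP/set_hmulP; exists a, b.
by split=> //; exact: dcoset_id.
Qed.

Lemma quot_preimage1 h : quot T @^-1` [set quot T h] = dcoset T h.
Proof.
by apply/seteqP; split=> x /=; [move=> /esym/quot_eqP|move=> /quot_eqP].
Qed.

Lemma quot_preimage_sub A B :
  quot T @^-1` A `<=` quot T @^-1` B -> A `<=` B.
Proof. by move=> AB X; have [x ->] := quot_surj X; exact: AB. Qed.

Definition quot_preimage W : closedSubset H :=
  ClosedSubset (quot_preimage_closed (csetP W)).

Lemma quot_preimage_sup W : T `<=` quot_preimage W.
Proof.
move=> x; rewrite -{1}dcoset1 => /quot_eqP /= <-.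
exact: (cset1 W).
Qed.

Lemma quot_preimage_dcoset W h :
  quot T @^-1` (dcoset W (quot T h)) = dcoset (quot_preimage W) h.
Proof.
have TV := @quot_preimage_sup W.
rewrite /dcoset !quot_preimageM quot_preimage1 -[quot T @^-1` W]/(cset (quot_preimage W)).
by rewrite /dcoset !set_hmulA (cset_mulSr TV) -set_hmulA (cset_mulSl TV).
Qed.

(** All relations that express centrality modulo [W] are pulled back to [H],
    where they become the relations modulo the preimage of [W]. *)
Lemma hcenter_quot_quot W h :
  hcenter (quotient (quot_preimage W)) (quot (quot_preimage W) h) ->
  hcenter (quotient W) (quot W (quot T h)).
Proof.
have TV := @quot_preimage_sup W.
case/hcenter_quotP=> hC hV; apply/hcenter_quotP; split=> [X|].
  have [x ->] := quot_surj X.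
  have E a b : quot T @^-1` (dcoset W (quot T a) ** dcoset W (quot T b)) =
      dcoset (quot_preimage W) a ** dcoset (quot_preimage W) b.
    by rewrite quot_preimageM !quot_preimage_dcoset.
  by apply/seteqP; split; apply: quot_preimage_sub; rewrite !E hC.
have -> : hstar (quot T h) = quot T (hstar h) by exact: quotient_starE.
apply: quot_preimage_sub; rewrite !quot_preimageM !quot_preimage1.
rewrite -[quot T @^-1` W]/(cset (quot_preimage W)) /dcoset.
have -> : T ** [set hstar h] ** T ** quot_preimage W ** (T ** [set h] ** T) =
    T ** ([set hstar h] ** quot_preimage W ** [set h]) ** T.
  by rewrite -!set_hmulA (set_hmulA (quot_preimage W)) (cset_mulSr TV)
    (set_hmulA T (quot_preimage W)) (cset_mulSl TV).
rewrite -[X in _ `<=` X](cset_mulSr TV) -[X in _ `<=` X ** _](cset_mulSl TV).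
by apply: set_hmulS => //; apply: set_hmulS.
Qed.

Lemma upper_center_quot i h :
  cset (upper_center H i) h ->
  cset (upper_center (quotient T) i) (quot T h).
Proof.
elim: i h => [_ -> //|i IH h hZ].
apply: hcenter_quot_quot; apply: hcenter_quot_sub hZ.
(* The induction hypothesis places Z_i(H) inside the preimage of Z_i(H//T). *)
exact: IH.
Qed.

End QuotientOfQuotient.

Theorem theorem1p7 (H : hypergroupType) (T : closedSubset H) :
  weakly_nilpotent H -> weakly_nilpotent (quotient T).
Proof.
case=> n Zn; exists n; apply/seteqP; split=> // X _.
have [h ->] := quot_surj X.
by apply: upper_center_quot; rewrite Zn.
Qed.
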